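(* Let $f:\mathbb{Z}\to\mathbb{T}$ and $k\in\mathbb{N}\cup\{0\}$. Suppose that the $k$-th discrete derivative $\Delta_1^kf:\mathbb{Z}\to\mathbb{T}$ is Bohr almost periodic. Then for all $\epsilon>0$, the set \[A=\big\{n\in\mathbb{N} : \|f(n)-f(0)\|<\epsilon\big\}\] is syndetic and its set of pairwise differences $A-A=\{a_1-a_2 : a_1,a_2\in A\}$ contains a Bohr neighborhood of zero. In particular, for any such $f$ and any $\epsilon>0$, the set \[\big\{m\in\mathbb{Z} : \inf_{n\in\mathbb{Z}}\|f(n+m)-f(n)\|<\epsilon\big\}\] contains a Bohr neighborhood of zero.
   Context: $\mathbb{N}=\{1,2,\ldots\}$ and $\mathbb{T}=\mathbb{R}/\mathbb{Z}$; $\|\cdot\|$ denotes the distance to zero on $\mathbb{T}$ or $\mathbb{T}^d$. The discrete derivative is $\Delta_1f(n)=f(n+1)-f(n)$, with $\Delta_1^0f=f$ and $\Delta_1^k$ its $k$-fold iterate. A Bohr neighborhood of zero is a set of the form $\{n\in\mathbb{Z}:\|n\alpha\|<\delta\}$ with $d\in\mathbb{N}$, $\alpha\in\mathbb{T}^d$ and $\delta>0$. A sequence $g:\mathbb{Z}\to\mathbb{T}$ is Bohr almost periodic if for all $\epsilon>0$ the set $\{m\in\mathbb{Z}:\sup_{n\in\mathbb{Z}}\|g(n+m)-g(n)\|<\epsilon\}$ contains a Bohr neighborhood of zero. A set $A\subseteq\mathbb{N}$ is syndetic if there is a finite set $F\subseteq\mathbb{N}$ such that for every $n\in\mathbb{N}$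 there is $j\in F$ with $n+j\in A$. *)

(* Defs.v *)
From HB Require Import structures.
From mathcomp Require Import all_boot all_order all_algebra.
From mathcomp Require Import boolp classical_sets functions cardinality reals.

Set Implicit Arguments.
Unset Strict Implicit.
Unset Printing Implicit Defensive.

Import Order.TTheory GRing.Theory Num.Theory.
Local Open Scope classical_set_scope.
Local Open Scope ring_scope.

Definition int_subgroup (R : realType) : zmodClosed R :=
  GRing.ZmodClosed.clone R (@Num.int_num_subdef R) _.

(* The circle R/Z. Despite its name, {ideal_quot _} is also the quotient of an
   additive group by a subgroup. *)
Definition torus (R : realType) : zmodType := {ideal_quot (int_subgroup R)}.

Definition torus_pi (R : realType) (x : R) : torus R :=
  \pi_({ideal_quot (int_subgroup R)})%qT x.

(* The quotient norm: the least absolute value of a real representative. *)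
Definition torus_norm (R : realType) (t : torus R) : R :=
  inf [set `|x| | x in [set x : R | torus_pi x = t]].

(* Distance to zero on T^d, for the maximum metric. *)
Definition torus_dnorm (R : realType) (d : nat) (a : 'rV[torus R]_d) : R :=
  \big[Num.max/0]_(i < d) torus_norm (a ord0 i).

Definition bohr_set (R : realType) (d : nat) (a : 'rV[torus R]_d) (delta : R) :
  set int := [set n | torus_dnorm (a *~ n) < delta].

Definition bohr_nbhd0 (R : realType) (B : set int) : Prop :=
  exists (d : nat) (a : 'rV[torus R]_d) (delta : R),
    [/\ (0 < d)%N, 0 < delta & B = bohr_set a delta].

Definition contains_bohr_nbhd0 (R : realType) (S : set int) : Prop :=
  exists B : set int, bohr_nbhd0 R B /\ B `<=` S.

Definition Delta1 (V : zmodType) (f : int -> V) : int -> V :=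
  fun n => f (n + 1) - f n.

(* The values of torus_norm lie in [0, 1/2], so the real-valued sup is a genuine
   supremum. *)
Definition bohr_almost_periodic (R : realType) (g : int -> torus R) : Prop :=
  forall eps : R, 0 < eps ->
    contains_bohr_nbhd0 R
      [set m : int |
        sup (range (fun n : int => torus_norm (g (n + m) - g n))) < eps].

(* The natural numbers start at 1 here, for the set, the shifts and the base
   points alike. *)
Definition syndetic (A : set nat) : Prop :=
  exists F : set nat,
    [/\ finite_set F,
        F `<=` [set j | (0 < j)%N] &
        forall n : nat, (0 < n)%N -> exists2 j : nat, F j & A (n + j)%N].

Definition difference_set (A : set nat) : set int :=
  [set a1%:Z - a2%:Z | a1 in A & a2 in A].

(* Main.v *)
(* Write [h m n = f (n + m) - f n]; its derivative of order [k - 1] is again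
   almost periodic. Syndeticity follows by induction on [k] from this remark and
   a pigeonhole argument. It reduces the claim on differences to finding, for
   every [m] in some Bohr neighborhood of 0, a window of prescribed length on
   which [h m] is small.

   The latter is again proved by induction on [k]. The hypothesis for the
   derivative of [f] gives a long window on which [h m] varies slowly, while the
   derivative of order [k] of [h m] is tiny everywhere. If [h m] never stays
   near 0 along a window, then its representatives in [0, 1[ form a bounded real
   sequence with tiny derivative of order [k], so they vary slowly, and this
   propagates to all larger [n]: the shift [m] is "confined". Fixing one
   confined shift [q], one lifts [f] to a real sequence along progressions of
   difference [q], and the mean slope of this lift is one more frequency, which
   excludes confined shifts from a Bohr neighborhood of 0. *)

Require Import Defs.
From mathcomp Require Import all_boot all_order all_algebra.
From mathcomp Require Import boolp classical_sets functions cardinality reals.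
From mathcomp Require Import lra zify ring.

Set Implicit Arguments.
Unset Strict Implicit.
Unset Printing Implicit Defensive.

Import Order.TTheory GRing.Theory Num.Theory.
Local Open Scope classical_set_scope.
Local Open Scope ring_scope.

(** * The circle: real representatives and the quotient norm *)

Section Circle.
Variable R : realType.
Implicit Types (x y c : R) (t u : torus R).

Lemma torus_pi0 : torus_pi (0 : R) = 0.
Proof. exact: (raddf0 (\pi_({ideal_quot (int_subgroup R)})%qT)). Qed.

Lemma torus_piB x y : torus_pi (x - y) = torus_pi x - torus_pi y.
Proof. exact: (raddfB (\pi_({ideal_quot (int_subgroup R)})%qT)). Qed.

Lemma torus_piN x : torus_pi (- x) = - torus_pi x.
Proof. by rewrite -[in LHS]sub0r torus_piB torus_pi0 sub0r. Qed.

Lemma torus_piD x y : torus_pi (x + y) = torus_pi x + torus_pi y.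
Proof. by rewrite -[y in LHS]opprK torus_piB torus_piN opprK. Qed.

Lemma torus_piMn x n : torus_pi (x *+ n) = torus_pi x *+ n.
Proof.
by elim: n => [|n IHn]; rewrite ?mulr0n ?torus_pi0 // !mulrS torus_piD IHn.
Qed.

Lemma torus_pi_sum (F : nat -> R) n :
  torus_pi (\sum_(i < n) F i) = \sum_(i < n) torus_pi (F i).
Proof. exact: (big_morph _ torus_piD torus_pi0). Qed.

Lemma torus_pi_eq x y : torus_pi x = torus_pi y <-> x - y \is a Num.int.
Proof.
split=> [/eqP|xy]; last apply/eqP.
  by rewrite /torus_pi -Quotient.idealrBE.
by rewrite /torus_pi -Quotient.idealrBE.
Qed.

Lemma torus_pi_sub_int x (z : int) : torus_pi (x - z%:~R) = torus_pi x.
Proof.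
by apply/torus_pi_eq; rewrite addrAC subrr sub0r rpredN intr_int.
Qed.

Lemma torus_rep_exists t : exists x, torus_pi x = t /\ 0 <= x < 1.
Proof.
pose x : R := repr t; exists (x - (Num.floor x)%:~R); split.
  by rewrite torus_pi_sub_int /torus_pi reprK.
by have := floor_itv x; rewrite intrD => /andP [? ?]; apply/andP; split; lra.
Qed.

Definition torus_rep t : R := sval (cid (torus_rep_exists t)).

Lemma torus_repK t : torus_pi (torus_rep t) = t.
Proof. by have [] := svalP (cid (torus_rep_exists t)). Qed.

Lemma torus_rep_ge0 t : 0 <= torus_rep t.
Proof. by have [_ /andP []] := svalP (cid (torus_rep_exists t)). Qed.

Lemma torus_rep_lt1 t : torus_rep t < 1.
Proof. by have [_ /andP []] := svalP (cid (torus_rep_exists t)). Qed.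

Lemma int_norm_lt1 x : x \is a Num.int -> `|x| < 1 -> x = 0.
Proof.
move=> /intrP [z ->]; rewrite -intr_norm (ltr_int _ _ 1) => z1.
by have -> : z = 0 by lia.
Qed.

Lemma torus_norm_pi_le x : torus_norm (torus_pi x) <= `|x|.
Proof.
apply: ge_inf; last by exists x.
by exists 0 => _ [y _ <-].
Qed.

(** With [x] the representative in [0, 1[, every representative has absolute value at least [x] or
    at least [1 - x], so the infimum is reached at [x] or at [x - 1]. *)
Lemma torus_norm_attained t : exists2 x, torus_pi x = t & `|x| = torus_norm t.
Proof.
set x := torus_rep t.
have x0 : 0 <= x := torus_rep_ge0 t.
have x1 : x < 1 := torus_rep_lt1 t.
have xt : torus_pi x = t := torus_repK t.
have x1t : torus_pi (x - 1) = t by rewrite (torus_pi_sub_int x 1).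
have low y : torus_pi y = t -> x <= `|y| \/ 1 - x <= `|y|.
  rewrite -xt => /torus_pi_eq /intrP [z yxz].
  have [z0|z0] := leP 0 z.
    left; have : 0 <= z%:~R :> R by rewrite ler0z.
    by have := ler_norm y; lra.
  right; have : z%:~R <= (-1)%:~R :> R by rewrite ler_int; lia.
  by rewrite mulrN1z; have := ler_norm (- y); rewrite normrN; lra.
have ne : [set `|y| | y in [set y : R | torus_pi y = t]] !=set0.
  by exists `|x|, x.
have upx := torus_norm_pi_le x; have upx1 := torus_norm_pi_le (x - 1).
have nx : `|x| = x by rewrite ger0_norm.
have nx1 : `|x - 1| = 1 - x by rewrite ltr0_norm ?subr_lt0 // opprB.
rewrite x1t nx1 in upx1; rewrite xt nx in upx.
have [xle|xge] := leP x (1 - x).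
  exists x => //; apply/eqP; rewrite eq_le nx upx andbT.
  by apply: lb_le_inf => // _ [y /low [] ? <-] //; lra.
exists (x - 1) => //; apply/eqP; rewrite eq_le nx1 upx1 andbT.
by apply: lb_le_inf => // _ [y /low [] ? <-] //; lra.
Qed.

Lemma torus_norm_ge0 t : 0 <= torus_norm t.
Proof. by have [x _ <-] := torus_norm_attained t. Qed.

Lemma torus_norm0 : torus_norm (0 : torus R) = 0.
Proof.
apply/eqP; rewrite eq_le torus_norm_ge0 andbT.
by have := torus_norm_pi_le 0; rewrite torus_pi0 normr0.
Qed.

Lemma torus_norm_le_half t : torus_norm t <= 1 / 2.
Proof.
have x0 := torus_rep_ge0 t; have x1 := torus_rep_lt1 t.
have := torus_norm_pi_le (torus_rep t - 1).
have := torus_norm_pi_le (torus_rep t).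
rewrite (torus_pi_sub_int _ 1) torus_repK ger0_norm // ltr0_norm; lra.
Qed.

Lemma torus_normN t : torus_norm (- t) = torus_norm t.
Proof.
wlog suff : t / torus_norm (- t) <= torus_norm t.
  by move=> le; apply/eqP; rewrite eq_le le -{1}[t]opprK le.
have [x <- <-] := torus_norm_attained t.
by rewrite -torus_piN -normrN torus_norm_pi_le.
Qed.

Lemma torus_norm_distC t u : torus_norm (t - u) = torus_norm (u - t).
Proof. by rewrite -torus_normN opprB. Qed.

Lemma torus_normD t u : torus_norm (t + u) <= torus_norm t + torus_norm u.
Proof.
have [x <- <-] := torus_norm_attained t.
have [y <- <-] := torus_norm_attained u.
by rewrite -torus_piD (le_trans (torus_norm_pi_le _)) // ler_normD.
Qed.

Lemma torus_normB t u : torus_norm (t - u) <= torus_norm t + torus_norm u.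
Proof. by rewrite -(torus_normN u) torus_normD. Qed.

Lemma torus_norm_sum (F : nat -> torus R) n c :
  (forall i, (i < n)%N -> torus_norm (F i) <= c) ->
  torus_norm (\sum_(i < n) F i) <= n%:R * c.
Proof.
elim: n => [|n IHn] Fc; first by rewrite big_ord0 torus_norm0 mul0r.
rewrite big_ord_recr /= (le_trans (torus_normD _ _)) //.
rewrite -natr1 mulrDl mul1r lerD ?Fc ?IHn // => i ni.
by rewrite Fc // ltnW.
Qed.

(* [x] and the shortest representative differ by an integer of absolute value
   less than 1. *)
Lemma torus_norm_pi_small x :
  `|x| + torus_norm (torus_pi x) < 1 -> `|x| = torus_norm (torus_pi x).
Proof.
have [y yx <-] := torus_norm_attained (torus_pi x) => xy1.
suff /eqP : x - y = 0 by rewrite subr_eq0 => /eqP ->.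
apply: int_norm_lt1; first by apply/torus_pi_eq.
by rewrite (le_lt_trans (ler_normB _ _)).
Qed.

Lemma torus_rep_bounds t c :
  c <= torus_norm t -> c <= torus_rep t <= 1 - c.
Proof.
have x0 := torus_rep_ge0 t; have x1 := torus_rep_lt1 t.
have := torus_norm_pi_le (torus_rep t - 1).
have := torus_norm_pi_le (torus_rep t).
by rewrite (torus_pi_sub_int _ 1) torus_repK ger0_norm // ltr0_norm; lra.
Qed.

Lemma torus_norm_pi_ge x c : c <= x <= 1 - c -> c <= torus_norm (torus_pi x).
Proof.
move=> xc; have [y /torus_pi_eq /intrP [z yxz] <-] :=
  torus_norm_attained (torus_pi x).
have [z0|z0] := leP 0 z.
  have : 0 <= z%:~R :> R by rewrite ler0z.
  by have := ler_norm y; lra.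
have : z%:~R <= (-1)%:~R :> R by rewrite ler_int; lia.
by rewrite mulrN1z; have := ler_norm (- y); rewrite normrN; lra.
Qed.

(** The shortest representative [y] makes [q * y] an integer of absolute value less than 1, so
    [y = 0]. This turns divisibility by [q] into a Bohr condition on [m]. *)
Lemma torus_pi_div_small (m q : nat) : (0 < q)%N ->
  torus_norm (torus_pi (m%:R / q%:R : R)) < q%:R^-1 -> (q %| m)%N.
Proof.
move=> q0; have [y /torus_pi_eq /intrP [z yz] <-] :=
  torus_norm_attained (torus_pi (m%:R / q%:R : R)) => yq.
have q0' : 0 < q%:R :> R by rewrite ltr0n.
have yE : q%:R * y = (m%:Z + q%:Z * z)%:~R.
  rewrite intrD intrM -!pmulrn.
  have -> : y = m%:R / q%:R + z%:~R by rewrite -yz addrC subrK.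
  by field; rewrite gt_eqF.
have : q%:R * y = 0.
  apply: int_norm_lt1; first by rewrite yE intr_int.
  by rewrite normrM gtr0_norm // -ltr_pdivlMl // mulr1.
rewrite yE => /eqP; rewrite intr_eq0 => /eqP mqz.
by apply/dvdnP; exists `|z|%N; nia.
Qed.

End Circle.

(** * Iterated differences of sequences indexed by the natural numbers *)

Definition ddiff (V : zmodType) (f : nat -> V) (n : nat) : V := f n.+1 - f n.

Section Differences.
Variable V : zmodType.
Implicit Types f g : nat -> V.

Lemma eq_iter_ddiff (a k : nat) f g : (forall n, (a <= n)%N -> f n = g n) ->
  forall n, (a <= n)%N -> iter k (@ddiff V) f n = iter k (@ddiff V) g n.
Proof.
elim: k f g => [|k IHk] f g fg n an; first exact: fg.
rewrite !iterSr; apply: IHk an => {}n an.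
by rewrite /ddiff !fg // leqW.
Qed.

Lemma iter_ddiff_shift (k s : nat) f n :
  iter k (@ddiff V) (fun n => f (n + s)%N) n = iter k (@ddiff V) f (n + s)%N.
Proof. by elim: k f n => [|k IHk] f n //=; rewrite /ddiff !IHk. Qed.

Lemma iter_ddiffB (k : nat) f g n :
  iter k (@ddiff V) (fun n => f n - g n) n =
  iter k (@ddiff V) f n - iter k (@ddiff V) g n.
Proof.
elim: k n => [|k IHk] n //=; rewrite /ddiff !IHk !opprB !addrA.
by rewrite addrAC [X in X + _ = _]addrAC [RHS]addrAC.
Qed.

Lemma ddiff_telescope f n s : \sum_(i < s) ddiff f (n + i)%N = f (n + s)%N - f n.
Proof.
elim: s => [|s IHs]; first by rewrite big_ord0 addn0 subrr.
by rewrite big_ord_recr /= IHs /ddiff addrC addrA subrK addnS.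
Qed.

End Differences.

Lemma ddiff_torus_pi (R : realType) k (x : nat -> R) n :
  iter k (@ddiff (torus R)) (fun n => torus_pi (x n)) n =
  torus_pi (iter k (@ddiff R) x n).
Proof. by elim: k n => [|k IHk] n //=; rewrite /ddiff !IHk torus_piB. Qed.

Lemma iter_ddiff_le (R : realType) k (x : nat -> R) c n :
  (forall i, (i <= k)%N -> `|x (n + i)%N| <= c) ->
  `|iter k (@ddiff R) x n| <= 2 ^+ k * c.
Proof.
elim: k n => [|k IHk] n xc; first by rewrite mul1r -[n]addn0 xc.
rewrite /= {1}/ddiff (le_trans (ler_normB _ _)) //.
rewrite exprS -mulrA mulr_natl mulr2n lerD // IHk // => i ik.
  by rewrite addSnnS xc.
by rewrite xc // leqW.
Qed.

(** * Bohr sets of natural numbers, almost periodic derivatives and syndetic returns *)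

Section Bohr.
Variable R : realType.
Implicit Types (S : nat -> Prop) (f g : nat -> torus R).
Local Notation D := (@ddiff (torus R)).

(** A list of frequencies, possibly empty, makes intersections mere concatenations. Only shifts
    [m >= 0] occur; negative ones are recovered at the end because the norm is even. *)
Definition bohr_nat S : Prop :=
  exists (s : seq (torus R)) (delta : R), 0 < delta /\
    forall m, (forall a, a \in s -> torus_norm (a *+ m) < delta) -> S m.

Lemma bohr_nat_sub S S' : (forall m, S m -> S' m) -> bohr_nat S -> bohr_nat S'.
Proof. by move=> SS' [s [d [d0 sS]]]; exists s, d; split=> // m /sS /SS'. Qed.

Lemma bohr_natT S : (forall m, S m) -> bohr_nat S.
Proof. by move=> HS; exists [::], 1; split. Qed.

Lemma bohr_natI S S' :
  bohr_nat S -> bohr_nat S' -> bohr_nat (fun m => S m /\ S' m).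
Proof.
move=> [s [d [d0 sS]]] [s' [d' [d'0 sS']]].
exists (s ++ s'), (Num.min d d'); split; first by rewrite lt_min d0.
move=> m sm; split; [apply: sS => a sa | apply: sS' => a sa].
  by have := sm a; rewrite mem_cat sa lt_min => /(_ isT) /andP [].
by have := sm a; rewrite mem_cat sa orbT lt_min => /(_ isT) /andP [].
Qed.

Lemma bohr_nat_forall (I : finType) (S : I -> nat -> Prop) :
  (forall i, bohr_nat (S i)) -> bohr_nat (fun m => forall i, S i m).
Proof.
move=> HS; suff : bohr_nat (fun m => forall i, i \in enum I -> S i m).
  by apply: bohr_nat_sub => m Sm i; apply: Sm; rewrite mem_enum.
elim: (enum I) => [|i s IHs]; first exact: bohr_natT.
apply: bohr_nat_sub (bohr_natI (HS i) IHs) => m [Si Ss] j.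
by rewrite inE => /predU1P [->|/Ss].
Qed.

Lemma bohr_nat_mul (a : torus R) (e : R) : 0 < e ->
  bohr_nat (fun m => torus_norm (a *+ m) < e).
Proof.
by move=> e0; exists [:: a], e; split=> // m; apply; rewrite mem_head.
Qed.

Definition almost_periodic g : Prop := forall e : R, 0 < e ->
  bohr_nat (fun m => forall n, torus_norm (g (n + m)%N - g n) < e).

Lemma almost_periodic_sum (F : nat -> nat -> torus R) s :
  (forall i, almost_periodic (F i)) ->
  almost_periodic (fun n => \sum_(i < s) F i n).
Proof.
move=> HF e e0; have es0 : 0 < e / s.+1%:R by rewrite divr_gt0.
have := @bohr_nat_forall 'I_s _ (fun i => HF i _ es0).
apply: bohr_nat_sub => m Fm n; rewrite -sumrB.
have := @torus_norm_sum _ (fun i => F i (n + m)%N - F i n) s (e / s.+1%:R).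
move=> /(_ _)/le_lt_trans; apply.
  by move=> i si; apply/ltW/(Fm (Ordinal si)).
by rewrite mulrA ltr_pdivrMr // mulrC ltr_pM2l // ltr_nat.
Qed.

Definition ap_order k f : Prop := almost_periodic (iter k D f).

Lemma ap_order_shift k f s : ap_order k f -> ap_order k (fun n => f (n + s)%N).
Proof.
move=> ff e /ff; apply: bohr_nat_sub => m fm n.
by rewrite !(iter_ddiff_shift k s f) addnAC.
Qed.

(** By telescoping, the derivative of order [k] of the increment is a sum of [s] translates of the
    derivative of order [k.+1]. *)
Lemma ap_order_incr k f s :
  ap_order k.+1 f -> ap_order k (fun n => f (n + s)%N - f n).
Proof.
move=> ff.
have fs i : almost_periodic (fun n => iter k.+1 D f (n + i)%N).
  by move=> e /ff; apply: bohr_nat_sub => m fm n; rewrite addnAC.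
move=> e e0; apply: (bohr_nat_sub _ (almost_periodic_sum s fs e0)) => m /= fm n.
by rewrite !(iter_ddiffB k (fun n => f (n + s)%N)) !(iter_ddiff_shift k s f)
  -!ddiff_telescope.
Qed.

(** Returns are simultaneous over a finite family because the induction must control the increments
    by several shifts at once. *)
Definition recurrent (P : (nat -> torus R) -> Prop) : Prop :=
  forall (I : finType) (f : I -> nat -> torus R), (forall x, P (f x)) ->
  forall e : R, 0 < e -> exists L, forall n, exists j,
    [/\ (0 < j)%N, (j <= L)%N & forall x, torus_norm (f x (n + j)%N - f x 0%N) < e].

(** The circle is cut into arcs of length [1 / M < e]. The bound [J] does not depend on [v], so a
    sequence can be built afterwards with a tolerance adapted to [J]. *)
Lemma pigeonhole (I : finType) (e : R) : 0 < e ->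
  exists J, forall v : nat -> I -> torus R,
  exists i j, [/\ (i < j)%N, (j <= J)%N & forall x, torus_norm (v j x - v i x) < e].
Proof.
move=> e0; pose M := (Num.truncn e^-1).+1.
have M0 : 0 < M%:R :> R by rewrite ltr0n.
have Me : M%:R^-1 < e.
  rewrite invf_plt ?posrE //.
  by have /andP [] := truncn_itv (ltW (etrans (invr_gt0 _) e0)).
exists #|{ffun I -> 'I_M.+1}| => v.
pose c (i : 'I_#|{ffun I -> 'I_M.+1}|.+1) : {ffun I -> 'I_M.+1} :=
  [ffun x => inord (Num.truncn (M%:R * torus_rep (v i x)))].
have /injectivePn [i [j ij cij]] : ~~ injectiveb c.
  by apply/negP => /injectiveP /leq_card; rewrite card_ord ltnn.
have close x : torus_norm (v j x - v i x) < e.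
  have xpos (t : torus R) : 0 <= M%:R * torus_rep t.
    by rewrite mulr_ge0 ?ler0n ?torus_rep_ge0.
  have xlt (t : torus R) : (Num.truncn (M%:R * torus_rep t) < M.+1)%N.
    rewrite truncn_lt_nat // (@lt_trans _ _ M%:R) ?ltr_nat //.
    by rewrite gtr_pMr // torus_rep_lt1.
  have := congr1 val (congr1 (fun F : {ffun _} => F x) cij).
  rewrite !ffunE /= !inordK // => tij.
  have := truncn_itv (xpos (v i x)); have := truncn_itv (xpos (v j x)).
  rewrite tij -natr1 => vj vi; apply: le_lt_trans Me.
  rewrite -(torus_repK (v j x)) -(torus_repK (v i x)) -torus_piB.
  rewrite (le_trans (torus_norm_pi_le _)) // -(ler_pM2l M0) divff ?gt_eqF //.
  by rewrite -[M%:R in X in X <= _]gtr0_norm // -normrM mulrBr ler_norml; lra.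
have [ij'|ji|] := ltngtP (i : nat) j.
- by exists i, j; split=> //; rewrite -ltnS.
- exists j, i; split=> //; first by rewrite -ltnS.
  by move=> x; rewrite torus_norm_distC.
- by move/val_inj/eqP; rewrite (negPf ij).
Qed.

(* If the return times of [f] were not syndetic, one could choose, from
   arbitrarily long intervals avoiding them, a sequence [s] whose differences
   all avoid them, while [P'] makes [f (s j) - f (s j - s i)] close to
   [f (s i) - f 0]. By pigeonhole [f (s j)] is close to [f (s i)] for some
   [i < j], so that [s j - s i] is a return time after all. *)
Lemma recurrent_step (P P' : (nat -> torus R) -> Prop) :
  recurrent P' ->
  (forall f s p, P f -> P' (fun n => f (n + p + s)%N - f (n + p)%N)) ->
  recurrent P.
Proof.
move=> rP' PP' I f Pf e e0; apply: contrapT => nosyn.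
pose bad m := ~ forall x, torus_norm (f x m - f x 0%N) < e.
have thick L : exists n, forall j, (0 < j <= L)%N -> bad (n + j)%N.
  apply: contrapT => nothick; apply: nosyn; exists L => n.
  apply: contrapT => noj; apply: nothick; exists n => j /andP [j0 jL] fj.
  by apply: noj; exists j.
have e20 : 0 < e / 2 by rewrite divr_gt0.
have [J HJ] := pigeonhole I e20.
pose eta := e / 2 / J.+1%:R.
have eta0 : 0 < eta by rewrite divr_gt0.
have [s Hs] : exists s : nat -> nat, forall i j, (i <= j <= J)%N ->
    [/\ (s i <= s j)%N, (i < j)%N -> bad (s j - s i)%N &
      forall x, torus_norm ((f x (s j) - f x (s j - s i)%N)
        - (f x (s i) - f x 0%N)) <= j%:R * eta].
  elim: J {HJ eta0} eta (eta0) => [|J IHJ] eta eta0.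
    exists (fun=> 0%N) => i j; rewrite leqn0 => /andP [ij /eqP j0].
    move: ij; rewrite {}j0 leqn0 => /eqP ->; split=> // x.
    by rewrite !subrr torus_norm0 mul0r.
  have [s Hs] := IHJ eta eta0.
  (* The increment for the pair [(x, i)] is [f x (s J) - f x (s J - s i)] at 0, and at [m] it is the
     one needed for the new point [s J + m]; one [l] serves all pairs. *)
  have Pg (y : I * 'I_J.+1) := PP' _ (s y.2) (s J - s y.2)%N (Pf y.1).
  have [L HL] := rP' _ _ Pg _ eta0.
  (* The extra length [s J] is there because the new differences are [m + (s J - s i)]. *)
  have [n0 Hn0] := thick (L + s J)%N.
  have [l [l0 lL Hl]] := HL n0.
  pose m := (n0 + l)%N; exists (fun i => if (i <= J)%N then s i else (s J + m)%N).
  move=> i j /andP [ij]; rewrite leq_eqVlt ltnS => /orP [/eqP jJ|jJ]; last first.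
    by rewrite /= jJ (leq_trans ij jJ); apply: Hs; rewrite ij.
  rewrite /= jJ ltnn; have [iJ|Ji] := leqP i J; last first.
    have iE : i = J.+1 by apply/eqP; rewrite eqn_leq Ji andbT -jJ.
    rewrite iE ltnn leqnn subnn; split=> // x.
    by rewrite subrr torus_norm0 mulr_ge0 // ltW.
  have [sij _ err] := Hs i J (introT andP (conj iJ (leqnn J))).
  have mE : (s J + m - s i = m + (s J - s i))%N by rewrite addnC addnBA.
  split; first by rewrite (leq_trans sij) ?leq_addr.
    by move=> _; rewrite mE -addnA; apply: Hn0; lia.
  move=> x; have := Hl (x, Ordinal (n:=J.+1) iJ); rewrite /= -/m.
  rewrite mE -!addnA subnK // !add0n [(s J + m)%N]addnC => lm.
  rewrite -natr1 mulrDl mul1r [leRHS]addrC.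
  apply: le_trans (lerD (ltW lm) (err x)); apply: le_trans (torus_normD _ _).
  by rewrite addrA subrK -addnA.
have [i [j [ij jJ vij]]] := HJ (fun i x => f x (s i)).
have [_ /(_ ij) + err] := Hs i j (introT andP (conj (ltnW ij) jJ)); apply=> x.
have -> : f x (s j - s i)%N - f x 0%N = (f x (s j) - f x (s i)) -
    ((f x (s j) - f x (s j - s i)%N) - (f x (s i) - f x 0%N)).
  by rewrite opprB addrA subrKA opprB addrC subrKA.
rewrite (le_lt_trans (torus_normB _ _)) //.
have -> : e = e / 2 + e / 2 by lra.
rewrite ltr_leD // (le_trans (err x)) // /eta mulrA ler_pdivrMr //.
by rewrite mulrC ler_pM2l // ler_nat leqW.
Qed.

(** Increments of linear sequences are constant, and constants return at once. The outcome is that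
    Bohr neighborhoods of 0 are syndetic. *)
Lemma recurrent_linear : recurrent (fun f => exists a, forall n, f n = a *+ n).
Proof.
apply: (@recurrent_step _ (fun f => exists c, forall n, f n = c)).
  move=> I f fc e e0; exists 1%N => n; exists 1%N; split=> // x.
  by have [c fE] := fc x; rewrite !fE subrr torus_norm0.
by move=> f s p [a fE]; exists (a *+ s) => n; rewrite !fE -mulrnBr ?leq_addr // addKn.
Qed.

Lemma recurrent_ap_order k : recurrent (ap_order k).
Proof.
elim: k => [|k IHk]; last first.
  by apply: (recurrent_step IHk) => f s p /(ap_order_incr s) /(ap_order_shift p).
move=> I f fap e e0.
(* For [k = 0], the common almost periods contain a Bohr set, and the linear sequences of its
   frequencies show that this set is syndetic. *)
have [s [d [d0 sd]]] := bohr_nat_forall (fun x => fap x e e0).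
pose g (i : 'I_(size s)) n := s`_i *+ n.
have gl i : exists a, forall n, g i n = a *+ n by exists s`_i.
have [L HL] := recurrent_linear gl d0.
exists L => n; have [j [j0 jL gj]] := HL n.
exists j; split=> // x; suff /(_ x 0%N) : forall x n', torus_norm (f x (n' + (n + j))%N - f x n') < e by [].
apply: sd => a /(nthP 0) [i si <-].
by have := gj (Ordinal si); rewrite /g mulr0n subr0.
Qed.

End Bohr.

(** * Real sequences: flatness, polynomial rigidity, means and slopes *)

Section RealSequences.
Variable R : realType.
Implicit Types (x y : nat -> R) (e c : R).
Local Notation D := (@ddiff R).

Lemma ddiff_sum_le x e n s :
  (forall i, (i < s)%N -> `|D x (n + i)%N| <= e) ->
  `|x (n + s)%N - x n| <= s%:R * e.
Proof.
move=> xe; rewrite -ddiff_telescope (le_trans (ler_norm_sum _ _ _)) //.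
rewrite mulr_natl -[s in X in _ <= X]card_ord -sumr_const.
by apply: ler_sum => i _; apply: xe.
Qed.

Lemma natr_unbounded e : exists n, e < n%:R.
Proof.
exists (Num.truncn `|e|).+1; rewrite (le_lt_trans (ler_norm e)) //.
by have /andP [] := truncn_itv (normr_ge0 e).
Qed.

(** By induction on [k]: if the derivative of order [k.+2] is tiny, the one of order [k.+1] is
    almost constant, while its sums telescope to bounded quantities; so it is itself small, and the
    induction hypothesis applies on subwindows. *)
Lemma ddiff_flat k N e : 0 < e -> exists N0 eta, [/\ (N <= N0)%N, 0 < eta &
  forall x, (forall t, (t <= N0)%N -> 0 <= x t <= 1) ->
    (forall t, (t + k.+1 <= N0)%N -> `|iter k.+1 D x t| <= eta) ->
    forall t, (t < N0)%N -> `|D x t| <= e].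
Proof.
move=> e0; elim: k N => [|k IHk] N.
  by exists N, e; split=> // x _ xe t tN; apply: xe; rewrite addn1.
(* [N.+1] rather than [N] ensures that [N1] is positive. *)
have [N1 [eta1 [NN1 eta10 H1]]] := IHk N.+1.
(* With this [M], the telescoped bound [2 ^+ k.+1] contributes at most [eta1 / 2] to the mean of
   [y]; the two variations of [y] take the remaining quarters. *)
have [M HM] := natr_unbounded (2 ^+ k.+2 / eta1).
have M0 : (0 < M)%N.
  by rewrite -(ltr_nat R) (le_lt_trans _ HM) // divr_ge0 ?exprn_ge0 // ltW.
have M0' : 0 < M%:R :> R by rewrite ltr0n.
pose N0 := (M + N1 + k.+2)%N.
have N00 : 0 < N0%:R :> R by rewrite ltr0n /N0 addnS.
pose eta := eta1 / (4 * N0%:R).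
have eta0 : 0 < eta by rewrite divr_gt0 // mulr_gt0.
have N0eta : N0%:R * eta = eta1 / 4 by rewrite /eta; field; rewrite gt_eqF.
exists N0, eta; split=> //; first by rewrite /N0; lia.
move=> x x01 xeta.
set z := iter k D x; set y := iter k.+1 D x.
have ybnd t : (t + k.+1 <= N0)%N -> `|y t| <= eta1.
  have yy0 s : (s + k.+1 <= N0)%N -> `|y s - y 0%N| <= eta1 / 4.
    move=> sN; rewrite -N0eta -[s]add0n.
    apply: le_trans (ddiff_sum_le (e := eta) _) _.
      by move=> i si; rewrite add0n; apply: (xeta i); lia.
    by rewrite ler_pM2r // ler_nat; lia.
  have zbnd s : (s + k <= N0)%N -> `|z s| <= 2 ^+ k.
    move=> sN; rewrite -[2 ^+ k]mulr1; apply: iter_ddiff_le => i ik.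
    have /andP [x0 x1] : 0 <= x (s + i)%N <= 1 by apply: x01; lia.
    by rewrite ger0_norm.
  have My0 : M%:R * `|y 0%N| <= 2 ^+ k.+1 + M%:R * (eta1 / 4).
    have -> : M%:R * `|y 0%N| = `|\sum_(i < M) y (0 + i)%N - \sum_(i < M) (y i - y 0%N)|.
      rewrite -sumrB (eq_bigr (fun=> y 0%N)) => [|i _].
        by rewrite sumr_const card_ord -[y 0%N *+ M]mulr_natl normrM normr_nat.
      by rewrite add0n opprB addrC subrK.
    rewrite (le_trans (ler_normB _ _)) //; apply: lerD.
      rewrite (ddiff_telescope z 0 M) (le_trans (ler_normB _ _)) //.
      by rewrite exprS mulr_natl mulr2n lerD // zbnd /N0; lia.
    rewrite (le_trans (ler_norm_sum _ _ _)) //.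
    rewrite mulr_natl -[M in X in _ <= X]card_ord -sumr_const.
    by apply: ler_sum => i _; apply: yy0; rewrite /N0; have := ltn_ord i; lia.
  have y0 : `|y 0%N| <= eta1 * (3 / 4).
    rewrite -(ler_pM2l M0'); move: HM; rewrite ltr_pdivrMr // exprS.
    lra.
  move=> /yy0 yt; have := ler_normD (y t - y 0%N) (y 0%N); rewrite subrK; lra.
move=> t tN.
(* Start of a subwindow of length [N1] containing [t]: at [t] if it fits, and otherwise pushed back
   to end at [N0]. *)
pose s := if (t + N1 <= N0)%N then t else (N0 - N1)%N.
have [st ts sN] : [/\ (s <= t)%N, (t - s < N1)%N & (s + N1 <= N0)%N].
  by rewrite /s /N0 in tN *; case: ifP; split; lia.
have := iter_ddiff_shift 1 s x (t - s); rewrite /= subnK // => <-.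
apply: H1 ts => r rN; first by apply: x01; lia.
by rewrite (iter_ddiff_shift k.+1 s x); apply: ybnd; lia.
Qed.

(** By induction the first difference is constant, so [x] is affine, and boundedness forces its
    slope to be 0. *)
Lemma bounded_poly_const k a x c :
  (forall n, (a <= n)%N -> `|x n| <= c) ->
  (forall n, (a <= n)%N -> iter k D x n = 0) ->
  forall n, (a <= n)%N -> x n = x a.
Proof.
elim: k x c => [|k IHk] x c xc xk n an; first by move: (xk n an) (xk a (leqnn a)) => /= -> ->.
have dx r : (a <= r)%N -> D x r = D x a.
  apply: (IHk (D x) (c + c)) => s sa; last by rewrite -iterSr xk.
  by rewrite (le_trans (ler_normB _ _)) // lerD // xc // leqW.
have xE j : x (a + j)%N = x a + j%:R * D x a.
  elim: j => [|j IHj]; first by rewrite addn0 mul0r addr0.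
  rewrite addnS -natr1 mulrDl mul1r addrA -IHj -(dx (a + j)%N) ?leq_addr //.
  by rewrite /ddiff addrC subrK.
have [D0|D0] := eqVneq (D x a) 0.
  by rewrite -(subnKC an) xE D0 mulr0 addr0.
have [j] := natr_unbounded ((c + c) / `|D x a|).
rewrite ltr_pdivrMr ?normr_gt0 // -(normr_nat R j) -normrM ltNge => /negP [].
have -> : j%:R * D x a = x (a + j)%N - x a by rewrite xE addrC addKr.
by rewrite (le_trans (ler_normB _ _)) // lerD // xc // leq_addr.
Qed.

(** Since [B] does not depend on [n0], it is negligible against large [M]: [r] is a limit point of
    the means of [y]. *)
Lemma mean_itv y c r :
  (forall e, 0 < e -> exists B, forall n0, exists2 M, (n0 <= M)%N &
    `|\sum_(j < M) y j - M%:R * r| <= B + e * M%:R) ->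
  (forall j, c <= y j <= 1 - c) -> c <= r <= 1 - c.
Proof.
move=> yr yc.
have sumy M : M%:R * c <= \sum_(j < M) y j <= M%:R * (1 - c).
  rewrite !mulr_natl -[M in c *+ M]card_ord -[M in (1 - c) *+ M]card_ord.
  by rewrite -!sumr_const !ler_sum // => j _; have /andP [] := yc j.
have far e : 0 < e -> (forall M : nat,
  M%:R * e <= `|\sum_(j < M) y j - M%:R * r|) -> False.
  move=> e0 yM; have e20 : 0 < e / 2 by rewrite divr_gt0.
  have [B' HB] := yr _ e20; have [n0 Hn0] := natr_unbounded (B' / (e / 2)).
  have [M n0M HM] := HB n0; have := yM M; move: Hn0; rewrite ltr_pdivrMr // => Hn0.
  have : n0%:R * (e / 2) <= M%:R * (e / 2) by rewrite ler_pM2r // ler_nat.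
  lra.
rewrite !leNgt; apply/andP; split; apply/negP => rc.
  apply: (far (c - r)); rewrite ?subr_gt0 // => M.
  rewrite ger0_norm; have /andP [+ _] := sumy M; have := ler0n R M; nra.
apply: (far (r - (1 - c))); rewrite ?subr_gt0 // => M.
rewrite ler0_norm; have /andP [_ +] := sumy M; have := ler0n R M; nra.
Qed.

(** Here [theta] is the limsup of [S j / j], obtained as the infimum of the slopes that eventually
    bound [S] from above. It is approached along infinitely many [j]. *)
Lemma limsup_slope (S : nat -> R) : (forall j, 0 <= S j <= j%:R) ->
  exists theta, forall e, 0 < e -> forall n0, exists2 j, (n0 <= j)%N &
    `|S j - theta * j%:R| <= e * j%:R.
Proof.
move=> S01.
pose E := [set c : R | exists n0, forall j, (n0 <= j)%N -> S j <= c * j%:R].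
have E1 : E 1 by exists 0%N => j _; rewrite mul1r; have /andP [] := S01 j.
have Elb : lbound E 0.
  move=> c [n0 /(_ n0.+1 (leqnSn _))]; have /andP [S0 _] := S01 n0.+1.
  by move=> /(le_trans S0); rewrite pmulr_lge0 // ltr0n.
have Einf : has_inf E by split; [exists 1 | exists 0].
exists (inf E) => e e0 n0.
have [c [n1 Hc] cE] := inf_adherent e0 Einf.
have : ~ E (inf E - e).
  move=> /(ge_inf (proj2 Einf)); lra.
move=> nE; have [j jn Sj] : exists2 j, (maxn n0 n1 <= j)%N & (inf E - e) * j%:R < S j.
  apply: contrapT => nj; apply: nE; exists (maxn n0 n1) => j jn.
  by rewrite leNgt; apply/negP => Sj; apply: nj; exists j.
move: jn; rewrite geq_max => /andP [n0j n1j]; exists j => //.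
have := Hc j n1j; rewrite ler_norml; have := ler0n R j; nra.
Qed.

End RealSequences.

(** * The alternative between small windows and confinement *)

Section Confinement.
Variable R : realType.
Implicit Types (f h : nat -> torus R) (c e : R).
Local Notation D := (@ddiff R).
Local Notation Dt := (@ddiff (torus R)).
Local Notation rep h := (fun n => torus_rep (h n)).

Lemma iter_ddiff_torus_rep k h n :
  torus_pi (iter k D (rep h) n) = iter k Dt h n.
Proof.
rewrite -ddiff_torus_pi; apply: (@eq_iter_ddiff _ 0) => // {}n _.
exact: torus_repK.
Qed.

(** The last value is the derivative of order [k] corrected by the [k] preceding values, whose
    binomial coefficients have absolute sum [2 ^+ k - 1]. *)
Lemma ddiff_extrapolate k h n c e : 0 <= c ->
  (forall i, (i < k)%N -> torus_norm (h (n + i)%N) <= c) ->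
  torus_norm (iter k Dt h n) <= e ->
  torus_norm (h (n + k)%N) <= e + (2 ^+ k - 1) * c.
Proof.
move=> c0; elim: k h c c0 => [|k IHk] h c c0 hc he.
  by rewrite addn0 subrr mul0r addr0.
have dh i : (i < k)%N -> torus_norm (Dt h (n + i)%N) <= c + c.
  move=> ik; rewrite (le_trans (torus_normB _ _)) // lerD ?hc // -?addnS ?hc //.
  by rewrite ltnW.
have hk : h (n + k.+1)%N = h (n + k)%N + Dt h (n + k)%N.
  by rewrite addnS addrC subrK.
rewrite hk (le_trans (torus_normD _ _)) //.
have := IHk (Dt h) (c + c) (addr_ge0 c0 c0) dh; rewrite -iterSr => /(_ he).
by have := hc k (leqnn _); rewrite exprS; lra.
Qed.

Definition confined c e h : Prop := exists a, forall n, (a <= n)%N ->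
  (c <= torus_rep (h n) <= 1 - c) /\ `|D (rep h) n| <= e.

(** Two representatives in [[c, 1 - c]] differ by at most [1 - 2 * c], so for [e < 2 * c] no integer
    jump can occur between them. *)
Lemma torus_rep_step c e h n : e < 2 * c ->
  c <= torus_norm (h n) -> c <= torus_norm (h n.+1) ->
  torus_norm (Dt h n) <= e -> `|D (rep h) n| <= e.
Proof.
move=> ec /torus_rep_bounds hn /torus_rep_bounds hn1 he.
have := iter_ddiff_torus_rep 1 h n; rewrite /= => piE.
have absD : `|D (rep h) n| <= 1 - 2 * c.
  by rewrite /ddiff ler_norml; apply/andP; split; lra.
by rewrite torus_norm_pi_small piE //; lra.
Qed.

(** A bootstrap. Without a small window, each block of length [N] has a value of norm at least
    [eps], and slowness keeps the norm above [eps / 2]. Then the representatives do not jump, their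
    derivative of order [k.+1] is tiny as a real number, [ddiff_flat] improves slowness from [e] to
    [e1], and extrapolation gives the bound [e] one step further. *)
Lemma slow_dichotomy k N (eps e : R) : 0 < e -> 2 ^+ k * e <= 1 / 4 ->
    e < eps -> N%:R * e <= eps / 2 ->
  exists L eta, 0 < eta /\ forall h,
    (forall n, torus_norm (iter k.+1 Dt h n) <= eta) ->
    (exists a, forall i, (i <= L)%N -> torus_norm (Dt h (a + i)%N) <= e) ->
    (exists n, forall i, (i <= N)%N -> torus_norm (h (n + i)%N) < eps) \/
    confined (eps / 2) e h.
Proof.
move=> e0 ke eeps Ne; pose e1 := e / (2 * 2 ^+ k).
have k0 : 0 < 2 ^+ k :> R by rewrite exprn_gt0.
have e10 : 0 < e1 by rewrite divr_gt0 // mulr_gt0.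
have e1E : 2 ^+ k * e1 = e / 2 by rewrite /e1; field; rewrite gt_eqF.
have [N0 [eta [kN0 eta0 flat]]] := ddiff_flat k k.+1 e10.
(* [N0] terms feed [ddiff_flat]; the other [N] are needed because the norm is bounded below only
   from [a + N] on. *)
exists (N0 + N)%N, (Num.min eta (e / 2)).
split=> [|h]; first by rewrite lt_min eta0 divr_gt0.
move=> heta0; have heta n : torus_norm (iter k.+1 Dt h n) <= eta /\
    torus_norm (iter k.+1 Dt h n) <= e / 2.
  by apply/andP; rewrite -le_min.
move=> [a ha]; have [good|bad] := pselect
  (exists n, forall i, (i <= N)%N -> torus_norm (h (n + i)%N) < eps).
  by left.
right.
have far B n : (forall i, (i <= B)%N -> torus_norm (Dt h (a + i)%N) <= e) ->
    (a + N <= n <= a + B.+1)%N -> eps / 2 <= torus_norm (h n).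
  move=> slow /andP [an nB].
  have [i iN hi] : exists2 i, (i <= N)%N & eps <= torus_norm (h (n - N + i)%N).
    apply: contrapT => ni; apply: bad; exists (n - N)%N => i iN.
    by rewrite ltNge; apply/negP => hi; apply: ni; exists i.
  have : torus_norm (h n - h (n - N + i)%N) <= N%:R * e.
    have -> : n = (n - N + i + (N - i))%N by lia.
    rewrite {2}[(n - N + i + (N - i))%N](_ : _ = n); last by lia.
    rewrite -ddiff_telescope.
    apply: le_trans (torus_norm_sum (F := fun j => Dt h (n - N + i + j)%N) (c := e) _) _.
      move=> j jN; rewrite [(n - N + i + j)%N](_ : _ = (a + (n - N + i + j - a))%N); last by lia.
      by apply: slow; lia.
    by rewrite ler_pM2r // ler_nat leq_subr.
  have := torus_normD (h n) (h (n - N + i)%N - h n).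
  by rewrite addrC subrK torus_norm_distC; lra.
have step B n : (forall i, (i <= B)%N -> torus_norm (Dt h (a + i)%N) <= e) ->
    (a + N <= n <= a + B)%N -> `|D (rep h) n| <= e.
  move=> slow /andP [an nB]; apply: (@torus_rep_step (eps / 2)); first by lra.
  - by apply: (far B) => //; lia.
  - by apply: (far B) => //; lia.
  - by rewrite -(subnKC (leq_trans (leq_addr N a) an)); apply: slow; lia.
have slow B i : (i <= N0 + N + B)%N -> torus_norm (Dt h (a + i)%N) <= e.
  elim: B i => [|B IHB] i; first by rewrite addn0; apply: ha.
  rewrite leq_eqVlt addnS ltnS => /orP [/eqP ->|/IHB //].
  (* [p] starts the last window of length [N0] before the new index. *)
  set B' := (N0 + N + B)%N in IHB *; pose p := (a + B'.+1 - N0)%N.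
  have dp t : (t < N0)%N -> torus_norm (Dt h (p + t)%N) <= e1.
    move=> tN0; have := iter_ddiff_torus_rep 1 h (p + t); rewrite /= => <-.
    rewrite (le_trans (torus_norm_pi_le _)) //.
    have := iter_ddiff_shift 1 p (rep h) t; rewrite /= addnC => <-.
    apply: flat tN0 => r rN0.
      by rewrite torus_rep_ge0 ltW ?torus_rep_lt1.
    rewrite (iter_ddiff_shift k.+1 p (rep h)).
    have [hr _] := heta (r + p)%N; rewrite -iter_ddiff_torus_rep in hr.
    rewrite torus_norm_pi_small //.
    have : torus_norm (torus_pi (iter k.+1 D (rep h) (r + p)%N)) <= 1 / 2.
      exact: torus_norm_le_half.
    suff : `|iter k.+1 D (rep h) (r + p)%N| <= 2 ^+ k * e by lra.
    rewrite iterSr; apply: iter_ddiff_le => j jk.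
    by apply: (step B') => //; rewrite /p /B'; lia.
  have -> : (a + B'.+1 = (a + B'.+1 - k) + k)%N by rewrite /B'; lia.
  have := @ddiff_extrapolate k (Dt h) (a + B'.+1 - k)%N e1 (e / 2) (ltW e10).
  move=> /(_ _ _)/le_trans; apply; last by rewrite mulrBl e1E mul1r; lra.
    move=> i' ik; have -> : (a + B'.+1 - k + i' = p + (a + B'.+1 - k + i' - p))%N.
      by rewrite /p /B'; lia.
    by apply: dp; rewrite /p /B'; lia.
  by rewrite -iterSr; have [] := heta (a + B'.+1 - k)%N.
exists (a + N)%N => n an.
have slown : forall i, (i <= n)%N -> torus_norm (Dt h (a + i)%N) <= e.
  by move=> i _; apply: (slow i); rewrite leq_addl.
split; last by apply: (step n) => //; rewrite an leq_addl.
by apply/torus_rep_bounds/(far n) => //; rewrite an; lia.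
Qed.

End Confinement.

(** * Exclusion of confined shifts and recurrence along windows *)

Section Recurrence.
Variable R : realType.
Implicit Types (f h : nat -> torus R) (c e : R).
Local Notation D := (@ddiff R).
Local Notation Dt := (@ddiff (torus R)).
Local Notation rep h := (fun n => torus_rep (h n)).

(** The bound [1 - 2 * c] leaves room for a quotient norm below [c], so that smallness modulo 1
    becomes smallness of the real difference. *)
Lemma confined_iter_osc k c e h a : c <= 1 / 4 -> 2 ^+ k * e <= 1 / 4 ->
  (forall n, (a <= n)%N ->
    (c <= torus_rep (h n) <= 1 - c) /\ `|D (rep h) n| <= e) ->
  forall n n', (a <= n)%N -> (a <= n')%N ->
  `|iter k D (rep h) n - iter k D (rep h) n'| <= 1 - 2 * c.
Proof.
move=> c4 ke ha n n' an an'; case: k ke => [|k] ke.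
  have [hn _] := ha n an; have [hn' _] := ha n' an'.
  by rewrite /= ler_norml; apply/andP; split; lra.
have bnd r : (a <= r)%N -> `|iter k.+1 D (rep h) r| <= 2 ^+ k * e.
  move=> ar; rewrite iterSr; apply: iter_ddiff_le => i _.
  by have [] := ha (r + i)%N (leq_trans ar (leq_addr _ _)).
rewrite (le_trans (ler_normB _ _)) // (le_trans (lerD (bnd n an) (bnd n' an'))) //.
by move: ke; rewrite exprS; lra.
Qed.

(* If [q] is a confined shift, then for a confined multiple [m] of [q] the
   integer-valued function [J] comparing representatives is eventually
   [q]-periodic. Averaging along [q]-progressions then shows that
   [m * theta / q] is congruent mod 1 to a mean of representatives of
   [f (n + m) - f n], hence stays away from 0; here [theta] is the drift of the
   sums of the representatives of [f (n + q) - f n]. *)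
Lemma not_confined_bohr k f c e : ap_order k.+1 f ->
  0 < c <= 1 / 4 -> 2 ^+ k * e <= 1 / 4 ->
  bohr_nat R (fun m => ~ confined c e (fun n => f (n + m)%N - f n)).
Proof.
move=> fap /andP [c0 c4] ke; pose h s n := f (n + s)%N - f n.
have [[q [aq hq]]|noq] := pselect (exists q, confined c e (h q)); last first.
  by apply: bohr_natT => m hm; apply: noq; exists m.
have q0 : (0 < q)%N.
  rewrite lt0n; apply/eqP => qE; have [+ _] := hq aq (leqnn _).
  move=> /torus_norm_pi_ge; rewrite torus_repK qE /h addn0 subrr torus_norm0.
  by move=> /(lt_le_trans c0); rewrite ltxx.
have q0' : 0 < q%:R :> R by rewrite ltr0n.
pose x := rep (h q); pose S j := \sum_(i < j) x (aq + q * i)%N.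
have S01 j : 0 <= S j <= j%:R.
  rewrite sumr_ge0 => [|i _]; last exact: torus_rep_ge0.
  rewrite -[j in j%:R]card_ord -sum1_card natr_sum ler_sum // => i _.
  exact/ltW/torus_rep_lt1.
have [theta Htheta] := limsup_slope S01.
(* Three conditions on [m]: it is an almost period of the derivative of order [k] of [h q],
   [m * theta / q] is near 0 modulo 1, and [q] divides [m]. *)
have := bohr_natI (ap_order_incr q fap c0)
  (bohr_natI (bohr_nat_mul (torus_pi (theta / q%:R)) c0)
    (bohr_nat_mul (torus_pi (1 / q%:R : R)) (etrans (invr_gt0 _) q0'))).
apply: bohr_nat_sub => m [hqm [mtheta mq]] [am hm].
have {mq} qm : (q %| m)%N.
  by apply: (@torus_pi_div_small R) => //; move: mq; rewrite -torus_piMn -[_ / _ *+ m]mulr_natl mul1r.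
have [s mE] := dvdnP qm.
have {}mtheta : torus_norm (torus_pi (s%:R * theta)) < c.
  move: mtheta; rewrite -torus_piMn -[_ / _ *+ m]mulr_natl mE natrM.
  by have -> : s%:R * q%:R * (theta / q%:R) = s%:R * theta by field; rewrite gt_eqF.
pose y := rep (h m); pose a0 := maxn aq am.
pose J n := \sum_(i < s) x (n + q * i)%N - y n.
have tele (V : zmodType) (g : nat -> V) n :
    \sum_(i < s) (g (n + q * i + q)%N - g (n + q * i)%N) = g (n + m)%N - g n.
  have := ddiff_telescope (fun i => g (n + q * i)%N) 0 s.
  rewrite add0n muln0 addn0 [(q * s)%N]mulnC -mE => <-.
  by apply: eq_bigr => i _; rewrite /ddiff add0n mulnSr addnA.
have piJ n : torus_pi (J n) = 0.
  rewrite torus_piB (torus_pi_sum (fun i => x (n + q * i)%N)) torus_repK.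
  rewrite (eq_bigr (fun i : 'I_s => h q (n + q * i)%N)) => [|i _].
    by rewrite (tele _ f) subrr.
  exact: torus_repK.
pose E n := J (n + q)%N - J n.
have EE n : E n = (x (n + m)%N - x n) - (y (n + q)%N - y n).
  rewrite /E /J -(tele _ x) sumrB; move: (y n) (y _) => u v.
  rewrite (eq_bigr (fun i : 'I_s => x (n + q * i + q)%N)) => [|i _].
    by ring.
  by rewrite addnAC.
have Ek n : (a0 <= n)%N -> iter k D E n = 0.
  rewrite geq_max => /andP [aqn amn].
  have -> : iter k D E n = (iter k D x (n + m)%N - iter k D x n) -
      (iter k D y (n + q)%N - iter k D y n).
    rewrite (_ : E = fun n => (x (n + m)%N - x n) - (y (n + q)%N - y n)).
      rewrite (iter_ddiffB k (fun n => x (n + m)%N - x n)).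
      rewrite (iter_ddiffB k (fun n => x (n + m)%N)) (iter_ddiffB k (fun n => y (n + q)%N)).
      by rewrite (iter_ddiff_shift k m x) (iter_ddiff_shift k q y).
    by apply/funext.
  (* [X] and [Y] agree modulo 1 because increments by [m] and by [q] commute; both have absolute
     value below [c], so they are equal. *)
  set X := iter k D x (n + m)%N - _; set Y := iter k D y (n + q)%N - _.
  have piX : torus_norm (torus_pi X) < c.
    by rewrite torus_piB !iter_ddiff_torus_rep; apply: hqm.
  have piY : torus_pi Y = torus_pi X.
    rewrite !torus_piB !iter_ddiff_torus_rep /h.
    rewrite -!(iter_ddiff_shift k _ (fun n => f (n + _)%N - f n)) -!iter_ddiffB.
    apply: (@eq_iter_ddiff _ 0) => // r _.
    rewrite !opprB addrACA [RHS]addrACA [(r + q + m)%N]addnAC; congr (_ + _).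
    exact: addrC.
  have Xc : `|X| < c.
    rewrite torus_norm_pi_small //.
    have := confined_iter_osc c4 ke hq (leq_trans aqn (leq_addr m n)) aqn.
    by rewrite -/x -/X; lra.
  have Yc : `|Y| < c.
    rewrite torus_norm_pi_small ?piY //.
    have := confined_iter_osc c4 ke hm (leq_trans amn (leq_addr q n)) amn.
    by rewrite -/y -/Y; lra.
  apply: int_norm_lt1; last by rewrite (le_lt_trans (ler_normB _ _)) //; lra.
  by rewrite -[X - Y]subr0; apply/torus_pi_eq; rewrite torus_piB piY subrr torus_pi0.
have Jbnd n : `|J n| <= s%:R + 1.
  rewrite (le_trans (ler_normB _ _)) // lerD //.
    rewrite (le_trans (ler_norm_sum _ _ _)) //.
    rewrite -[s in s%:R]card_ord -sum1_card natr_sum ler_sum // => i _.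
    by rewrite ger0_norm ?torus_rep_ge0 // ltW ?torus_rep_lt1.
  by rewrite ger0_norm ?torus_rep_ge0 // ltW ?torus_rep_lt1.
have Ebnd n : (a0 <= n)%N -> `|E n| <= (s%:R + 1) + (s%:R + 1).
  by move=> _; rewrite (le_trans (ler_normB _ _)) // lerD.
have Ec := bounded_poly_const Ebnd Ek.
(* A starting point beyond [a0] that lies on the progression used to define [S]. *)
pose a := (aq + q * a0)%N.
have aa0 : (a0 <= a)%N by rewrite /a; nia.
have Ea j : J (a + q * j)%N = J a.
  have -> : J (a + q * j)%N = J (a + q * (0 + j))%N by [].
  rewrite -[a in RHS]addn0 -[0%N in RHS](muln0 q).
  (* Along the progression [J] is bounded with constant increment [E a0], hence constant. *)
  apply: (@bounded_poly_const R 2 0 (fun j => J (a + q * j)%N)) => // r _.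
  have EJ i : D (fun j => J (a + q * j)%N) i = E a0.
    rewrite -(Ec (a + q * i)%N) ?(leq_trans aa0) ?leq_addr // /ddiff /E.
    by rewrite mulnSr addnA.
  by rewrite /= /ddiff [X in X - _]EJ [X in _ - X]EJ subrr.
have [z Jz] : exists z : int, J a = z%:~R.
  by apply/intrP; rewrite -[J a]subr0; apply/torus_pi_eq; rewrite piJ torus_pi0.
have yc j : c <= y (a + q * j)%N <= 1 - c.
  by have [] := hm _ (leq_trans (leq_maxr aq am) (leq_trans aa0 (leq_addr (q * j) a))).
suff mean e' : 0 < e' -> exists B, forall n0, exists2 M, (n0 <= M)%N &
    `|\sum_(j < M) y (a + q * j)%N - M%:R * (s%:R * theta - z%:~R)| <= B + e' * M%:R.
  have /torus_norm_pi_ge := mean_itv mean yc.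
  by rewrite torus_pi_sub_int leNgt mtheta.
move=> e'0.
(* The increments of [U] are the sums of [x] occurring in [J], so the sums of [y] telescope;
   moreover [U j] is within [s ^ 2] of [s * S j]. *)
pose U j := \sum_(i < s) S (j + i)%N.
have SD j : D S j = x (aq + q * j)%N by rewrite /ddiff /S big_ord_recr /= addrAC subrr add0r.
have sumy M : \sum_(j < M) y (a + q * j)%N = U (a0 + M)%N - U a0 - M%:R * z%:~R.
  rewrite -(ddiff_telescope U) mulr_natl -[M in _ *+ M]card_ord -sumr_const -sumrB.
  apply: eq_bigr => j _; rewrite -Jz -(Ea j) /J /ddiff -sumrB.
  rewrite [X in X - _](eq_bigr (fun i : 'I_s => x (a + q * j + q * i)%N)).
    by rewrite opprB addrC subrK.
  by move=> i _; rewrite addSn -/(D S _) SD /a; congr x; lia.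
have US j : `|U j - s%:R * S j| <= s%:R * s%:R.
  rewrite [s%:R * S j]mulr_natl -[s in _ *+ s]card_ord -sumr_const -sumrB.
  rewrite (le_trans (ler_norm_sum _ _ _)) // mulr_natl -[s in _ *+ s]card_ord.
  rewrite -sumr_const ler_sum // => i _.
  have := @ddiff_sum_le R S 1 j i; rewrite mulr1 => /(_ _)/le_trans; apply.
    by move=> r _; rewrite SD ger0_norm ?torus_rep_ge0 // ltW ?torus_rep_lt1.
  by rewrite ler_nat ltnW.
have es0 : 0 < e' / s.+1%:R by rewrite divr_gt0.
exists (s%:R * s%:R + e' * a0%:R + s%:R * `|theta| * a0%:R + `|U a0|) => n0.
have [j nj Hj] := Htheta _ es0 (n0 + a0)%N.
exists (j - a0)%N; first by lia.
rewrite sumy subnKC; last by lia.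
have jE : (j - a0)%:R = j%:R - a0%:R :> R by rewrite natrB //; lia.
have sj : s%:R * `|S j - theta * j%:R| <= e' * j%:R.
  rewrite (le_trans (ler_wpM2l (ler0n R s) Hj)) // mulrA ler_wpM2r //.
  by rewrite mulrCA ger_pMr // ler_pdivrMr // mul1r ler_nat.
rewrite jE.
have -> : U j - U a0 - (j%:R - a0%:R) * z%:~R - (j%:R - a0%:R) * (s%:R * theta - z%:~R) =
    (U j - s%:R * S j) + s%:R * (S j - theta * j%:R) + s%:R * theta * a0%:R - U a0.
  by ring.
rewrite (le_trans (ler_normB _ _)) //.
have := ler_normD (U j - s%:R * S j + s%:R * (S j - theta * j%:R)) (s%:R * theta * a0%:R).
have := ler_normD (U j - s%:R * S j) (s%:R * (S j - theta * j%:R)).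
by rewrite !normrM !normr_nat; have := US j; lra.
Qed.

(** Windows of every length [N] are carried through the induction because [slow_dichotomy] needs
    slowness along a window of length [L]. *)
Lemma recurrence_window k f : ap_order k f -> forall (eps : R) N, 0 < eps ->
  bohr_nat R (fun m => exists n, forall i, (i <= N)%N ->
    torus_norm (f (n + i + m)%N - f (n + i)%N) < eps).
Proof.
elim: k f => [|k IHk] f fap eps N eps0.
  by apply: bohr_nat_sub (fap _ eps0) => m fm; exists 0%N => i _; apply: fm.
(* The cap [1 / 2] makes [c = eps' / 2] at most [1 / 4], and [e] meets the three smallness
   conditions of [slow_dichotomy]. *)
pose eps' := Num.min eps (1 / 2).
have eps'0 : 0 < eps' by rewrite lt_min eps0 divr_gt0.
have eps'2 : eps' <= 1 / 2 by rewrite ge_min lexx orbT.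
pose e := eps' / (4 * 2 ^+ k * N.+1%:R).
have k1 : 1 <= 2 ^+ k :> R by rewrite exprn_ege1 // ler1n.
have N1 : 1 <= N.+1%:R :> R by rewrite ler1n.
have eE : e * (4 * 2 ^+ k * N.+1%:R) = eps'.
  by rewrite /e divfK // gt_eqF // !mulr_gt0 // exprn_gt0.
have e0 : 0 < e by rewrite divr_gt0 // !mulr_gt0 // exprn_gt0.
have ek1 : e <= 2 ^+ k * e by rewrite ler_peMl // ltW.
have ekN : 2 ^+ k * e <= 2 ^+ k * e * N.+1%:R by rewrite ler_peMr // mulr_ge0 // ltW // exprn_gt0.
have ek : 2 ^+ k * e <= 1 / 4 by lra.
have eeps : e < eps' by lra.
have Ne : N%:R * e <= eps' / 2.
  have : N.+1%:R * e <= N.+1%:R * (2 ^+ k * e) by rewrite ler_pM2l.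
  by rewrite -natr1; lra.
have [L [eta [eta0 dich]]] := slow_dichotomy e0 ek eeps Ne.
have c4 : 0 < eps' / 2 <= 1 / 4 by apply/andP; split; lra.
have dfap : ap_order k (@ddiff (torus R) f) by rewrite /ap_order -iterSr.
have := bohr_natI (IHk _ dfap e L e0)
  (bohr_natI (fap _ eta0) (not_confined_bohr fap c4 ek)).
apply: bohr_nat_sub => m [[a ha] [hm nconf]].
have [|||//] := dich (fun n => f (n + m)%N - f n).
- move=> n; rewrite (iter_ddiffB k.+1 (fun n => f (n + m)%N)).
  by rewrite (iter_ddiff_shift k.+1 m f); apply/ltW/hm.
- exists a => i iL; have := ltW (ha i iL).
  have := iter_ddiffB 1 (fun n => f (n + m)%N) f (a + i); rewrite /= => ->.
  by have := iter_ddiff_shift 1 m f (a + i); rewrite /= => ->.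
move=> [n hn]; exists n => i iN; apply: (lt_le_trans (hn i iN)).
by rewrite ge_min lexx.
Qed.

End Recurrence.

(** * Passage between natural shifts and Bohr neighborhoods in the integers *)

Section Transfer.
Variable R : realType.

Lemma torus_dnorm_lt d (a : 'rV[torus R]_d) (delta : R) : 0 < delta ->
  torus_dnorm a < delta <-> forall i, torus_norm (a ord0 i) < delta.
Proof.
move=> d0; rewrite /torus_dnorm; split=> [/bigmax_ltP [_ H] i|H]; first exact: H.
by apply/bigmax_ltP; split.
Qed.

Lemma mulrz_row d (a : 'rV[torus R]_d) (n : int) i :
  (a *~ n) ord0 i = a ord0 i *~ n.
Proof.
have aMn m : (a *+ m) ord0 i = a ord0 i *+ m.
  by elim: m => [|m IHm]; rewrite ?mulr0n ?mxE // !mulrS mxE IHm.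
by case: n => n; rewrite ?NegzE ?mulrNz ?mxE aMn.
Qed.

Lemma torus_norm_mulrz (t : torus R) (n : int) :
  torus_norm (t *~ n) = torus_norm (t *+ `|n|).
Proof. by case: n => n; rewrite ?NegzE ?mulrNz ?torus_normN ?abszN. Qed.

Lemma bohr_nat_contains (S : nat -> Prop) (T : set int) : bohr_nat R S ->
  (forall m, S m -> T m%:Z /\ T (- m%:Z)) -> contains_bohr_nbhd0 R T.
Proof.
move=> [s [d [d0 sS]]] ST.
(* The extra frequency 0 makes the dimension positive even when [s] is empty. *)
pose a : 'rV[torus R]_(size s).+1 := \row_i (0 :: s)`_i.
exists (bohr_set a d); split; first by exists (size s).+1, a, d.
move=> n /(torus_dnorm_lt _ d0) an.
have [Tn TNn] : T `|n|%N%:Z /\ T (- `|n|%N%:Z).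
  apply: ST; apply: sS => t /(nthP 0) [i si <-].
  have := an (lift ord0 (Ordinal si)).
  by rewrite mulrz_row mxE torus_norm_mulrz.
have nE : n = `|n|%N%:Z \/ n = - `|n|%N%:Z by lia.
by case: nE => ->.
Qed.

Lemma bohr_almost_periodic_ap_order k (f : int -> torus R) :
  bohr_almost_periodic (iter k (@Delta1 (torus R)) f) ->
  ap_order k (fun n : nat => f n%:Z).
Proof.
move=> hf e e0; have [B [[d [a [delta [_ delta0 ->]]]] aB]] := hf e e0.
have fE n : iter k (@ddiff (torus R)) (fun n : nat => f n%:Z) n =
    iter k (@Delta1 (torus R)) f n%:Z.
  elim: k {hf aB} n => [|k IHk] n //=.
  by rewrite /ddiff /Delta1 !IHk -addn1 PoszD.
exists [seq a ord0 i | i <- enum 'I_d], delta; split=> // m am n.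
rewrite !fE PoszD; apply: le_lt_trans (aB m%:Z _); last first.
  apply/(torus_dnorm_lt _ delta0) => i; rewrite mulrz_row.
  by apply/am/map_f; rewrite mem_enum.
apply: ub_le_sup; last by exists n%:Z.
by exists (1 / 2) => _ [r _ <-]; apply: torus_norm_le_half.
Qed.

End Transfer.

Theorem theoremC (R : realType) (f : int -> torus R) (k : nat)
    (hf : bohr_almost_periodic (iter k (@Delta1 (torus R)) f))
    (eps : R) (heps : 0 < eps) :
  let A := [set n : nat | (0 < n)%N /\ torus_norm (f n%:Z - f 0) < eps] in
  [/\ syndetic A,
      contains_bohr_nbhd0 R (difference_set A) &
      contains_bohr_nbhd0 R
        [set m : int |
          inf (range (fun n : int => torus_norm (f (n + m) - f n))) < eps]].
Proof.
move=> A; have fap := bohr_almost_periodic_ap_order hf.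
have syn (e : R) : 0 < e -> exists L, forall n, exists j,
    [/\ (0 < j)%N, (j <= L)%N & torus_norm (f (n + j)%N%:Z - f 0) < e].
  move=> e0; have [L HL] := recurrent_ap_order (I := unit) (fun=> fap) e0.
  by exists L => n; have [j [j0 jL /(_ tt) fj]] := HL n; exists j.
split.
- have [L HL] := syn _ heps.
  exists [set j | (0 < j)%N /\ (j <= L)%N]; split.
  + by apply: (sub_finite_set _ (finite_II L.+1)) => j /= [].
  + by move=> j [].
  + move=> n n0; have [j [j0 jL fj]] := HL n; exists j => //.
    by split=> //; rewrite addn_gt0 n0.
- have eps20 : 0 < eps / 2 by rewrite divr_gt0.
  (* A window of length [L] contains a return time [n + j] within [eps / 2]; moving it by [m] costs
     another [eps / 2], so [n + j] and [n + j + m] both lie in [A]. *)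
  have [L HL] := syn _ eps20.
  apply: bohr_nat_contains (recurrence_window fap L eps20) _ => m [n fm].
  have [j [j0 jL fj]] := HL n; have fjm := fm j jL.
  have An : A (n + j)%N.
    by split; [rewrite addn_gt0 j0 orbT | apply: lt_trans fj _; lra].
  have Anm : A (n + j + m)%N.
    split; first by rewrite !addn_gt0 j0 orbT.
    have := torus_normD (f (n + j + m)%N%:Z - f (n + j)%N%:Z) (f (n + j)%N%:Z - f 0).
    by rewrite subrKA; lra.
  split.
    exists (n + j + m)%N => //; exists (n + j)%N => //.
    by rewrite PoszD addrAC subrr add0r.
  exists (n + j)%N => //; exists (n + j + m)%N => //.
  by rewrite [in X in _ - X]PoszD opprD addrA subrr sub0r.
- have inf_lt (m n : int) : torus_norm (f (n + m) - f n) < eps ->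
      inf (range (fun n : int => torus_norm (f (n + m) - f n))) < eps.
    apply: le_lt_trans; apply: ge_inf; last by exists n.
    by exists 0 => _ [r _ <-]; apply: torus_norm_ge0.
  (* A single point [n] suffices; for [- m] the base point is [n + m]. *)
  apply: bohr_nat_contains (recurrence_window fap 0 heps) _ => m [n /(_ 0%N (leqnn 0))].
  rewrite addn0 => fm; split; first by apply: (inf_lt _ n%:Z).
  by apply: (inf_lt _ (n + m)%N%:Z); rewrite torus_norm_distC PoszD addrK.
Qed.
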